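(* Let $n>0$ and $0\le k\le n$ be integers. Then $$\sum_{\sigma\in\mathscr S_{n,k}}(-1)^{\operatorname{inv}(\sigma)}q^{\operatorname{maj}(\sigma)}=[k+1]_{(-1)^{k+n+nk}q}\,[k+2]_{(-1)^{k+1}q}\,[k+3]_{(-1)^{k+2}q}\cdots[n]_{(-1)^{n-1}q},$$ where the right-hand side has exactly one factor for each $j\in\{k+1,\dots,n\}$: the factor for $j=k+1$ is $[k+1]_{(-1)^{k+n+nk}q}$ and the factor for each $j$ with $k+2\le j\le n$ is $[j]_{(-1)^{j-1}q}$ (the product is empty, equal to $1$, if $k=n$).
   Context: For a nonnegative integer $m$ and an expression $x$, $[m]_x=1+x+\cdots+x^{m-1}$. $S_n$ is the symmetric group on $\{1,\dots,n\}$. For $\sigma\in S_n$, $\operatorname{inv}(\sigma)=|\{(i,j): i<j,\ \sigma(i)>\sigma(j)\}|$ and $\operatorname{maj}(\sigma)=\sum_{i:\ \sigma(i)>\sigma(i+1)} i$. For $n>0$ and $0\le k\le n$, $$\mathscr S_{n,k}=\{\sigma\in S_n:\ \sigma^{-1}(n-k+1)<\sigma^{-1}(n-k+2)<\cdots<\sigma^{-1}(n)\}$$ (so $\mathscr S_{n,0}=\mathscr S_{n,1}=S_n$). *)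

(* Defs.v *)
From mathcomp Require Import all_boot all_fingroup all_algebra.
Set Implicit Arguments.
Unset Strict Implicit.
Unset Printing Implicit Defensive.
Import GRing.Theory.

Local Open Scope ring_scope.

(* Permutations of {1, ..., n} are encoded as permutations of
   'I_n = {0, ..., n-1}: the ordinal i stands for the integer i + 1, both as
   a position and as a value. *)

Definition qint (R : comNzRingType) (m : nat) (x : R) : R :=
  \sum_(i < m) x ^+ i.

Definition inv_perm (n : nat) (s : 'S_n) : nat :=
  #|[set p : 'I_n * 'I_n | (p.1 < p.2)%N && (s p.2 < s p.1)%N]|.

(* The descent at 0-based positions i, i + 1 contributes i + 1, the 1-based
   position of its left end. *)
Definition maj_perm (n : nat) (s : 'S_n) : nat :=
  (\sum_(p : 'I_n * 'I_n | (p.2 == p.1.+1 :> nat) && (s p.2 < s p.1)) p.1.+1)%N.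

(* The permutations in which the k largest values n-k+1, ..., n (that is,
   the ordinals n-k, ..., n-1) occur in increasing order; meant for k <= n. *)
Definition Snk (n k : nat) : {set 'S_n} :=
  [set s : 'S_n | [forall v : 'I_n, forall w : 'I_n,
     (n - k <= v)%N && (w == v.+1 :> nat) ==>
       ((s^-1)%g v < (s^-1)%g w)%N]].

(* Main.v *)
Require Import Defs.
From mathcomp Require Import all_boot all_fingroup all_algebra.
From mathcomp Require Import zify ring.
Import GRing.Theory.

Set Implicit Arguments.
Unset Strict Implicit.
Unset Printing Implicit Defensive.

(** Write F(n, k) for the left-hand side.  The idea is to remove the two
    smallest values, 0 and 1, at once.  A permutation in which 0 and 1 do not
    stand next to each other is matched with the one where they are exchanged:
    no comparison between neighbours changes, so the major index stays, while
    the sign flips; these permutations cancel.  In the others 0 and 1 form a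
    block 01 or 10, inserted at one of the N + 1 slots of a word w of length
    N = n - 2.  The block contributes an even number of crossing inversions, so
    the slot only matters for the major index, and the sum over all slots of
    q^maj(01) - q^maj(10) turns out to be q^maj(w) times

      f_N = sum_(i <= N) (1 - q^(i+1)) q^i,

    whatever w is (sum_block_term, sum_insert2).  If k <= n - 2 the removal
    respects the condition on the k largest values, so
    F(n, k) = F(n - 2, k) f_(n-2) (signed_sum_rec).  Moreover
    f_(n-2) = [n-1]_((-1)^(n-2) q) [n]_((-1)^(n-1) q) (block_sum_qint): these
    are the last two factors of the product.  The exponent k + n + nk keeps its
    parity when n drops by two, so it is enough to know F(k, k) = 1, where only
    the identity is allowed, and F(k + 1, k) = [k+1]_(-q), where one smallest
    value is inserted after i letters of an increasing word and creates i
    inversions and major index i. *)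

(** * Major index of words *)

(** With x = 0 the first bit is always false, so the bit at index i tells
    whether the letters at 0-based positions i - 1 and i form a descent.  This
    is the descent that the major index counts with weight i. *)
Definition descents (x : nat) (w : seq nat) : seq bool :=
  pairmap (fun a b => b < a) x w.

Definition weight (bs : seq bool) : nat :=
  \sum_(i < size bs) i * nth false bs i.

Definition maj (w : seq nat) : nat := weight (descents 0 w).

Definition insert (i a : nat) (w : seq nat) : seq nat :=
  take i w ++ a :: drop i w.

Lemma maj_rcons w x : maj (rcons w x) = maj w + size w * (x < last 0 w).
Proof.
rewrite /maj /descents -cats1 pairmap_cat /= cats1 /weight size_rcons.
rewrite big_ord_recr /= nth_rcons ltnn eqxx size_pairmap; congr (_ + _).
by apply: eq_bigr => i _; rewrite nth_rcons size_pairmap ltn_ord.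
Qed.

Lemma descents_map_addn m w : descents 0 (map (addn m) w) = descents 0 w.
Proof.
rewrite /descents; case: w => //= a w; rewrite !ltn0; congr cons.
by elim: w a => //= b w IHw a; rewrite IHw ltn_add2l.
Qed.

Lemma maj_map_addn m w : maj (map (addn m) w) = maj w.
Proof. by rewrite /maj descents_map_addn. Qed.

(** The letters 0 and 1 are smaller than all others, so as long as they are not
    neighbours, exchanging them alters no comparison between neighbours. *)
Lemma maj_swap_apart (x y z : seq nat) :
  y != [::] -> all (leq 2) (x ++ y ++ z) ->
  maj (x ++ 0 :: y ++ 1 :: z) = maj (x ++ 1 :: y ++ 0 :: z).
Proof.
case: y => [//|c y] _; rewrite !all_cat => /and3P[xge2 yge2 zge2].
rewrite /maj; congr weight; rewrite /descents !(pairmap_cat, cat_cons) /=.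
rewrite !pairmap_cat /=; case/andP: yge2 => cge2 yge2.
have last_ge2 : 2 <= last c y.
  have := mem_last c y; rewrite inE => /predU1P[-> //|].
  by move/allP: yge2; apply.
have -> : (0 < last 0 x) = (1 < last 0 x).
  case: (lastP x) xge2 => // x' a; rewrite all_rcons last_rcons => /andP[]; lia.
have -> : (0 < last c y) = (1 < last c y) by lia.
congr (_ ++ _ :: _ :: _ ++ _ :: _); first by lia.
by case: z zge2 => //= a z /andP[age2 _]; congr cons; lia.
Qed.

Lemma map_insert (f : nat -> nat) i a w :
  map f (insert i a w) = insert i (f a) (map f w).
Proof. by rewrite /insert map_cat /= map_take map_drop. Qed.

Lemma iota_rcons m n : iota m n.+1 = rcons (iota m n) (m + n).
Proof. by rewrite -addn1 iotaD cats1. Qed.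

Lemma maj_iota n : maj (iota 1 n) = 0.
Proof.
elim: n => [|n IHn]; first by rewrite /maj /weight big_ord0.
rewrite iota_rcons maj_rcons IHn; case: n {IHn} => // n.
by rewrite iota_rcons last_rcons; lia.
Qed.

(** An increasing word in which 0 is inserted has its only descent, if any,
    just before the 0. *)
Lemma maj_insert_iota i m : maj (iota 1 i ++ 0 :: iota i.+1 m) = i.
Proof.
elim: m => [|m IHm].
  rewrite cats1 maj_rcons maj_iota size_iota; case: i => // i.
  by rewrite iota_rcons last_rcons; lia.
rewrite iota_rcons -rcons_cons -rcons_cat maj_rcons IHm last_cat /=.
case: m {IHm} => [|m]; first by rewrite /=; lia.
by rewrite iota_rcons last_rcons; lia.
Qed.

(** * Permutations as words, and insertion of a smallest value *)

Definition word (n : nat) (s : 'S_n) : seq nat :=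
  [seq val (s i) | i <- enum 'I_n].

Lemma size_word n (s : 'S_n) : size (word s) = n.
Proof. by rewrite size_map size_enum_ord. Qed.

Lemma nth_word n (s : 'S_n) (i : 'I_n) : nth 0 (word s) i = s i.
Proof. by rewrite (nth_map i) ?size_enum_ord // nth_ord_enum. Qed.

Lemma maj_word n (s : 'S_n) : maj_perm s = maj (word s).
Proof.
have -> : maj_perm s = \sum_(j < n)
    \sum_(i < n | (j == i.+1 :> nat) && (s j < s i)) i.+1.
  by rewrite (exchange_big_dep xpredT) //= pair_big_dep.
rewrite /maj /weight size_pairmap size_word; apply: eq_bigr => j _.
rewrite (nth_pairmap 0) ?size_word // nth_word.
case: (posnP j) => [j0|j_gt0].
  by rewrite j0 mul0n big_pred0 // => i; rewrite j0.
have lt_pj : j.-1 < n by rewrite (leq_ltn_trans (leq_pred _)).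
have -> : nth 0 (0 :: word s) j = s (Ordinal lt_pj).
  by rewrite -nth_word /= -[in LHS](prednK j_gt0).
rewrite big_mkcondr (big_pred1 (Ordinal lt_pj)) /=; last first.
  move=> i /=; apply/eqP/eqP => [ji|->]; last by rewrite /= prednK.
  by apply: val_inj; rewrite /= ji.
by rewrite prednK //; case: ifP; rewrite ?muln1 ?muln0.
Qed.

Lemma word_lift n (i : 'I_n.+1) (s : 'S_n) :
  word (lift_perm i ord0 s) = insert i 0 (map succn (word s)).
Proof.
have le_in : i <= size (map succn (word s)) by rewrite size_map size_word -ltnS.
apply: (@eq_from_nth _ 0) => [|j].
  rewrite size_word /insert size_cat /= size_drop size_takel // addnS subnKC //.
  by rewrite size_map size_word.
rewrite size_word => lt_jn; rewrite -[j]/(val (Ordinal lt_jn)).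
move: (Ordinal lt_jn) => {lt_jn}j; rewrite nth_word /insert nth_cat.
rewrite size_takel //.
case: (unliftP i j) => [j'|] -> ; last by rewrite lift_perm_id ltnn subnn.
rewrite lift_perm_lift lift0 -nth_word /= /bump.
case: (leqP i j') => [le_ij|lt_ji].
  rewrite add1n ltnNge leqW //= subSn //= nth_drop subnKC //.
  by rewrite (nth_map 0) ?size_word.
by rewrite add0n lt_ji nth_take // (nth_map 0) ?size_word.
Qed.

Lemma inv_perm_lift n (i : 'I_n.+1) (s : 'S_n) :
  inv_perm (lift_perm i ord0 s) = i + inv_perm s.
Proof.
have invE m (t : 'S_m) :
    inv_perm t = \sum_(a < m) \sum_(b < m) ((a < b) && (t b < t a)).
  rewrite /inv_perm -sum1dep_card big_mkcond pair_big /=.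
  by apply: eq_bigr => p _; case: ifP.
rewrite !invE (bigD1_ord i) //= lift_perm_id /= big1 ?add0n; last first.
  by move=> b _; rewrite ltn0 andbF.
under eq_bigr => a _.
  rewrite (bigD1_ord i) //= lift_perm_id lift_perm_lift /= andbT.
  under eq_bigr do rewrite lift_perm_lift /= !ltnNge /= !leq_bump2 -!ltnNge.
  over.
rewrite big_split /=; congr (_ + _).
rewrite -[RHS](card_ord i) -sum1_card.
have le_in : i <= n by rewrite -ltnS.
rewrite (big_ord_widen n (fun=> 1) le_in) [in RHS]big_mkcond.
apply: eq_bigr => a _; rewrite /bump (leqNgt i a).
by case: (ltnP a i) => /=; lia.
Qed.

(** Injectivity suffices, because both sides have (n + 1)! elements. *)
Lemma lift_perm0_bij n :
  bijective (fun p : 'I_n.+1 * 'S_n => lift_perm p.1 ord0 p.2).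
Proof.
apply: inj_card_bij => [[i s] [j t] /= eq_st|]; last first.
  by rewrite card_prod card_ord !card_Sn factS.
have eq_ij : i = j.
  apply: (@perm_inj _ (lift_perm i ord0 s)).
  by rewrite lift_perm_id eq_st lift_perm_id.
rewrite -{j}eq_ij in eq_st *; congr pair; apply/permP => a.
by apply: (@lift_inj _ ord0); rewrite -!(lift_perm_lift i) eq_st.
Qed.

(** Since k <= n, the inserted smallest value is not among the k largest. *)
Lemma Snk_lift n k (i : 'I_n.+1) (s : 'S_n) : k <= n ->
  (lift_perm i ord0 s \in Snk n.+1 k) = (s \in Snk n k).
Proof.
move=> le_kn; rewrite !inE lift_permV.
have liftE v w : (lift_perm ord0 i s^-1 (lift ord0 v) <
    lift_perm ord0 i s^-1 (lift ord0 w))%g = (s^-1 v < s^-1 w)%g.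
  by rewrite !lift_perm_lift /= !ltnNge leq_bump2.
apply/forallP/forallP => [incr v|incr v]; apply/forallP => w; apply/implyP.
  case/andP=> le_v /eqP w_v; rewrite -liftE.
  have /forallP/(_ (lift ord0 w))/implyP := incr (lift ord0 v).
  by apply; rewrite !lift0 w_v eqxx andbT subSn.
case/andP; rewrite subSn //.
case: (unliftP ord0 v) => [v'|] ->; last by rewrite ltn0.
case: (unliftP ord0 w) => [w'|] ->; last by [].
rewrite !lift0 eqSS ltnS => le_v w_v; rewrite liftE.
by have /forallP/(_ w')/implyP := incr v'; apply; rewrite le_v.
Qed.

Lemma Snn_id n : Snk n n = [set 1%g].
Proof.
apply/setP => s; rewrite !inE; apply/forallP/eqP => [incr|-> v]; last first.
  by apply/forallP => w; apply/implyP; rewrite invg1 !perm1 => /andP[_ /eqP->].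
suff wordV : word s^-1%g = word (1%g : 'S_n).
  apply: invg_inj; rewrite invg1; apply/permP => i; apply: val_inj.
  by rewrite /= -!nth_word wordV.
apply: (irr_sorted_eq ltn_trans ltnn).
- apply/(sortedP 0) => i; rewrite size_word => lt_in.
  have /forallP/(_ (Ordinal lt_in))/implyP := incr (Ordinal (ltnW lt_in)).
  by rewrite -!nth_word /= => ->; rewrite // subnn eqxx.
- apply/(sortedP 0) => i; rewrite size_word => lt_in.
  rewrite -[i]/(val (Ordinal (ltnW lt_in))) -[i.+1]/(val (Ordinal lt_in)).
  by rewrite !nth_word !perm1.
move=> a; apply/mapP/mapP => [[i _ ->]|[i _ ->]].
  by exists (s^-1%g i); rewrite ?mem_enum ?perm1.
by exists (s i); rewrite ?mem_enum ?permK ?perm1.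
Qed.

Lemma word1 n : word (1%g : 'S_n) = iota 0 n.
Proof.
by rewrite -val_enum_ord; apply: eq_map => i; rewrite perm1.
Qed.

Lemma inv_perm1 n : inv_perm (1%g : 'S_n) = 0.
Proof.
apply/eqP; rewrite cards_eq0; apply/eqP/setP => p; rewrite !inE !perm1.
by case: ltngtP.
Qed.

Local Open Scope ring_scope.

(** * Insertion of two smallest letters into a word *)

(** The i-th term is the contribution of the two blocks 01 and 10 inserted
    after i letters into an increasing word: 01 creates a descent of weight i,
    and 10 another one of weight i + 1 together with a sign. *)
Definition block_sum (R : comNzRingType) (q : R) (n : nat) : R :=
  \sum_(i < n) (1 - q ^+ i.+1) * q ^+ i.

(** This replaces the formula for block_sum as a fraction, since 1 - q ^+ 2 may
    be a zero divisor. *)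
Lemma block_sum_closed (R : comNzRingType) (q : R) n :
  (1 - q ^+ 2) * block_sum q n = (1 - q ^+ n) * (1 - q ^+ n.+1).
Proof.
rewrite /block_sum; elim: n => [|n IHn]; first by rewrite big_ord0; ring.
by rewrite big_ord_recr /= mulrDr IHn !exprS; ring.
Qed.

(** Raising n by one replaces the factor [n+1] by [n+3] at the same argument
    e q with e = (-1)^n, and [n+3] - [n+1] = q^(n+1) (1 + e q); the other factor
    [n+2], taken at - e q, is the geometric sum that turns 1 + e q into
    1 - q^(n+2). *)
Lemma block_sum_qint (R : comNzRingType) (q : R) n :
  block_sum q n.+1 =
  qint n.+1 ((-1) ^+ n * q) * qint n.+2 ((-1) ^+ n.+1 * q).
Proof.
have sign1 m : ((-1) ^+ m) ^+ m.+1 = 1 :> R.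
  by rewrite -exprM -signr_odd oddM /= andbN.
elim: n => [|n IHn].
  by rewrite /block_sum /qint !big_ord_recr !big_ord0 /=; ring.
rewrite /block_sum big_ord_recr /= -/(block_sum q n.+1) IHn.
have -> : qint n.+3 ((-1) ^+ n.+2 * q) =
   qint n.+1 ((-1) ^+ n * q) + q ^+ n.+1 * (1 + (-1) ^+ n * q).
  rewrite exprS [in LHS]exprS mulrA mulrNN !mul1r /qint !big_ord_recr /= -addrA.
  congr (_ + _).
  by rewrite (exprS _ n.+1) exprMn sign1; ring.
have geom : (1 + (-1) ^+ n * q) * qint n.+2 ((-1) ^+ n.+1 * q) = 1 - q ^+ n.+2.
  (* Both sides are - (x^(n+2) - 1) for x = (-1)^(n+1) q. *)
  have := subrX1 ((-1) ^+ n.+1 * q) n.+2.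
  rewrite exprMn sign1 mul1r -/(qint _ _) => powE.
  have -> : 1 - q ^+ n.+2 = - (q ^+ n.+2 - 1) by ring.
  by rewrite powE (exprS _ n); ring.
by rewrite -geom; ring.
Qed.

(** Splits the index pairs into a <= b and a > b and folds the second half onto
    the first by (b + 1, a) <-> (a, b).  When (a, b) are the insertion slots of
    0 and then of 1, this exchanges the places of the letters 0 and 1. *)
Lemma sum_triangle (V : zmodType) (G : nat -> nat -> V) n :
  \sum_(b < n) \sum_(a < n.+1) G a b =
  \sum_(b < n) \sum_(a < b.+1) (G a b + G b.+1 a).
Proof.
elim: n => [|n IHn]; first by rewrite !big_ord0.
rewrite big_ord_recr [in RHS]big_ord_recr /= -IHn.
under eq_bigr do rewrite big_ord_recr /=.
rewrite !big_split /= -!addrA; congr (_ + _).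
rewrite [X in _ + X = _]big_ord_recr [X in _ = _ + X]big_ord_recr /=.
by rewrite addrCA.
Qed.

Definition block_term (R : comNzRingType) (q : R) (w : seq nat) (i : nat) : R :=
  q ^+ maj (take i w ++ [:: 0%N, 1%N & drop i w]) -
  q ^+ maj (take i w ++ [:: 1%N, 0%N & drop i w]).

(** The block makes every later position move by two, hence size w + 2. *)
Lemma block_term_rcons (R : comNzRingType) (q : R) w x i : (1 < x)%N ->
  (i < size w)%N ->
  block_term q (rcons w x) i =
  block_term q w i * q ^+ ((size w).+2 * (x < last 0 w))%N.
Proof.
move=> x_gt1 ltiw; rewrite /block_term -!cats1 takel_cat ?(ltnW ltiw) //.
rewrite drop_cat ltiw -!cat_cons !catA !cats1 !maj_rcons !last_cat /=.
have lastE y : last y (drop i w) = last 0 w.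
  by rewrite -[in RHS](cat_take_drop i w) last_cat (drop_nth 0).
rewrite !lastE mulrBl -!exprD !size_cat /= size_takel ?(ltnW ltiw) //.
by rewrite size_drop !addnS subnKC // ltnW.
Qed.

Lemma block_term_size (R : comNzRingType) (q : R) w : all (leq 2) w ->
  block_term q w (size w) =
  q ^+ maj w * ((1 - q ^+ (size w).+1) * q ^+ size w).
Proof.
move=> wge2; rewrite /block_term take_size drop_size.
have cat2 a b : w ++ [:: a; b] = rcons (rcons w a) b by rewrite -!cats1 -catA.
rewrite !cat2 !maj_rcons !last_rcons !size_rcons /= muln0 addn0 muln1.
case: (lastP w) wge2 => [_|v x]; first by rewrite /= !mul0n !addn0 exprD; ring.
rewrite all_rcons last_rcons => /andP[xge2 _].
by rewrite (ltnW xge2) xge2 !muln1 !exprD; ring.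
Qed.

Lemma block_term_rcons_size (R : comNzRingType) (q : R) w x : (1 < x)%N ->
  block_term q (rcons w x) (size w) = block_term q w (size w).
Proof.
move=> x_gt1; rewrite /block_term -!cats1 takel_cat // take_size drop_size.
rewrite drop_cat ltnn subnn drop0 (catA w [:: 0; 1]%N [:: x]).
rewrite (catA w [:: 1; 0]%N [:: x]) !cats1 !(maj_rcons _ x) !last_cat /=.
by rewrite (ltnNge x) (ltnW x_gt1) !muln0 !addn0.
Qed.

(** The sum over the slots does not depend on the shape of w beyond its major
    index.  The slots other than the last one are summed by induction on w,
    adding a last letter x to a word of length N.  If x makes a descent, of
    weight N, every slot further left picks up q^(N+2), which exceeds the
    expected q^N by q^2, while the slot just before x loses the factor q^N
    because the descent disappears there; block_sum_closed says that these two
    effects compensate. *)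
Lemma sum_block_term (R : comNzRingType) (q : R) w : all (leq 2) w ->
  \sum_(i < (size w).+1) block_term q w i =
  q ^+ maj w * block_sum q (size w).+1.
Proof.
move=> wge2; rewrite big_ord_recr /= block_term_size // [in RHS]/block_sum.
rewrite big_ord_recr /= mulrDr; congr (_ + _); rewrite -/(block_sum q _).
elim/last_ind: w wge2 => [_|w x IHw].
  by rewrite /block_sum !big_ord0 mulr0.
rewrite all_rcons size_rcons => /andP[xge2 wge2]; rewrite big_ord_recr /=.
rewrite block_term_rcons_size // block_term_size //.
under eq_bigr do rewrite block_term_rcons //.
rewrite -mulr_suml IHw // maj_rcons /block_sum big_ord_recr /=.
rewrite -/(block_sum q _).
case: (x < last 0 w)%N; last by rewrite !muln0 addn0 expr0 mulr1; ring.
rewrite !muln1 exprD.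
have := block_sum_closed q (size w).
move: (block_sum q _) => S; rewrite mulrBl mul1r => /(canRL (subrK _)) SE.
rewrite [in RHS]SE !exprS; ring.
Qed.

(** The pairs of slots for which 0 and 1 are not neighbours cancel, by
    maj_swap_apart; what remains are the blocks 01 and 10. *)
Lemma sum_insert2 (R : comNzRingType) (q : R) w : all (leq 2) w ->
  \sum_(b < (size w).+1) \sum_(a < (size w).+2)
     (-1) ^+ (a + b) * q ^+ maj (insert a 0 (insert b 1 w)) =
  q ^+ maj w * block_sum q (size w).+1.
Proof.
move=> wge2; rewrite (sum_triangle (fun a b =>
  (-1) ^+ (a + b) * q ^+ maj (insert a 0 (insert b 1 w)))).
rewrite -sum_block_term //; apply: eq_bigr => b _.
have le_bw : (b <= size w)%N by rewrite -ltnS.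
have takeb : size (take b w) = b by rewrite size_takel.
have ins_low a : (a <= b)%N -> insert a 0 (insert b 1 w) =
    take a w ++ 0%N :: drop a (take b w) ++ 1%N :: drop b w.
  move=> le_ab; rewrite {1}/insert /insert takel_cat ?takeb // take_takel //.
  rewrite drop_cat takeb; case: (ltnP a b) => // le_ba.
  have -> : a = b by apply/eqP; rewrite eqn_leq le_ab.
  by rewrite subnn drop0 [drop b (take b w)]drop_oversize ?takeb.
have ins_high a : (a <= b)%N -> insert b.+1 0 (insert a 1 w) =
    take a w ++ 1%N :: drop a (take b w) ++ 0%N :: drop b w.
  move=> le_ab; have le_aw := leq_trans le_ab le_bw.
  have takea : size (take a w) = a by rewrite size_takel.
  rewrite {1}/insert /insert take_cat drop_cat takea ltnNge leqW //= subSn //=.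
  by rewrite -catA take_drop drop_drop subnK.
rewrite big_ord_recr /= big1 => [|a _].
  rewrite add0r ins_low // ins_high // /block_term.
  rewrite [drop b (take b w)]drop_oversize ?takeb //.
  by rewrite addSn exprS -signr_odd oddD addbb; ring.
have lt_ab := ltn_ord a; rewrite ins_low 1?ltnW // ins_high 1?ltnW //.
rewrite maj_swap_apart.
- by rewrite addSn exprS addnC; ring.
- by rewrite -size_eq0 size_drop takeb subn_eq0 -ltnNge.
- rewrite -[take a w](take_takel _ (ltnW lt_ab)) catA cat_take_drop.
  by rewrite cat_take_drop.
Qed.

(** * The signed sum over permutations *)

Definition signed_sum (R : comNzRingType) (q : R) (n k : nat) : R :=
  \sum_(s in Snk n k) (-1) ^+ inv_perm s * q ^+ maj_perm s.

Lemma sum_Snk_lift (V : zmodType) n k (F : 'S_n.+1 -> V) : (k <= n)%N ->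
  \sum_(s in Snk n.+1 k) F s =
  \sum_(s in Snk n k) \sum_(i < n.+1) F (lift_perm i ord0 s).
Proof.
move=> le_kn; rewrite exchange_big pair_big_dep.
rewrite (reindex _ (onW_bij _ (lift_perm0_bij n))).
by apply: eq_bigl => p; rewrite Snk_lift.
Qed.

Lemma signed_sum_id (R : comNzRingType) (q : R) n : signed_sum q n n = 1.
Proof.
rewrite /signed_sum Snn_id big_set1 inv_perm1 maj_word word1.
have -> : maj (iota 0 n) = 0%N.
  by rewrite -[RHS](maj_iota n) (iotaDl 1) maj_map_addn.
by rewrite !expr0 mulr1.
Qed.

Lemma signed_sum_one (R : comNzRingType) (q : R) k :
  signed_sum q k.+1 k = qint k.+1 (- q).
Proof.
rewrite /signed_sum sum_Snk_lift // Snn_id big_set1; apply: eq_bigr => i _.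
rewrite inv_perm_lift inv_perm1 addn0 maj_word word_lift word1.
rewrite -(iotaDl 1) /insert take_iota drop_iota.
have le_ik : (i <= k)%N by rewrite -ltnS.
by rewrite (minn_idPl le_ik) add1n maj_insert_iota -exprMn mulN1r.
Qed.

(** The two smallest values are inserted one after the other.  The second
    insertion raises all values by one, so the value inserted first ends as 1
    and the values of the initial permutation end raised by two. *)
Lemma signed_sum_rec (R : comNzRingType) (q : R) n k : (k <= n)%N ->
  signed_sum q n.+2 k = signed_sum q n k * block_sum q n.+1.
Proof.
move=> le_kn; rewrite /signed_sum !sum_Snk_lift ?leqW // mulr_suml.
apply: eq_bigr => s _.
pose w := map (addn 2) (word s).
have wge2 : all (leq 2) w by apply/allP => _ /mapP[a _ ->].
have size_w : size w = n by rewrite size_map size_word.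
have := sum_insert2 q wge2; rewrite size_w maj_map_addn -maj_word => sum_w.
rewrite -mulrA -sum_w mulr_sumr; apply: eq_bigr => b _.
rewrite mulr_sumr; apply: eq_bigr => a _.
rewrite !inv_perm_lift addnA exprD mulrAC -mulrA maj_word !word_lift map_insert.
by rewrite -map_comp [RHS]mulrC -mulrA.
Qed.

Theorem corollary3p4 (R : comNzRingType) (q : R) (n k : nat)
    (n_gt0 : (0 < n)%N) (le_kn : (k <= n)%N) :
  \sum_(s in Snk n k) (-1) ^+ inv_perm s * q ^+ maj_perm s =
  \prod_(k.+1 <= j < n.+1)
    (if j == k.+1 then qint j ((-1) ^+ (k + n + n * k) * q)
     else qint j ((-1) ^+ j.-1 * q)).
Proof.
rewrite -/(signed_sum q n k) -(subnK le_kn).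
move: (n - k)%N => d {n n_gt0 le_kn}.
(* The recursion lowers the number d = n - k of free values by two. *)
have [m] := ubnP d; elim: m d => // m IHm [|[|d]] lt_dm.
- by rewrite add0n signed_sum_id big_geq.
- rewrite add1n signed_sum_one big_nat1 eqxx; congr qint.
  by rewrite -signr_odd !oddD oddM /=; case: (odd k); rewrite /= mulN1r.
rewrite !addSn signed_sum_rec ?leq_addl // block_sum_qint IHm 1?ltnW //.
have le_k : (k <= d + k)%N by apply: leq_addl.
rewrite [in RHS]big_nat_recr 1?leqW //= [in RHS]big_nat_recr //= -mulrA.
rewrite [(d + k).+2 == _]gtn_eqF; last by rewrite !ltnS leq_addl.
(* For d = 0 the first new factor is the exceptional one, j = k + 1. *)
case: d {IHm lt_dm le_k} => [|d].
  rewrite !add0n eqxx !big_geq // !mul1r; congr (qint _ (_ * q) * _).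
  by rewrite -[RHS]signr_odd -[LHS]signr_odd !oddD oddM /= negbK; case: odd.
rewrite [(d.+1 + k).+1 == _]gtn_eqF ?ltnS ?leq_addl //; congr (_ * _).
apply: eq_big_nat => j _; case: ifP => // _; congr (qint _ (_ * q)).
by rewrite -[RHS]signr_odd -[LHS]signr_odd !(oddD, oddM) /= !negbK !oddD addNb.
Qed.
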